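(* Let $\varepsilon\in(0,\tfrac12)$ be the fixed constant of the planted-clique conjectures, let $k=k(n)$ satisfy $(2+\varepsilon)\log_2 n<k<n^{1/2-\varepsilon}$, and set $d=k-2$. For every constant $\delta>0$ the following two statements hold. (i) If the classical planted-clique conjecture PC holds, then no randomized polynomial-time algorithm, given $G$ and $d$, estimates $\beta_d(\mathrm{skel}_d X(G))$ to additive error below $\tfrac12$ with success probability at least $\tfrac12+\delta$ over $G\sim\mathcal{D}_k$ (and the algorithm's internal randomness). (ii) If the quantum planted-clique conjecture qPC holds, then no quantum polynomial-time algorithm with a classical output estimate satisfies the same guarantee.
   Context: Graphs are simple graphs on vertex set $[n]=\{1,\dots,n\}$; asymptotics are as $n\to\infty$. $G(n,\tfrac12)$ is the Erdős–Rényi distribution, where each of the $\binom n2$ edges is present independently with probability $\tfrac12$. $G(n,\tfrac12,k)$ is obtained by drawing $G_0\sim G(n,\tfrac12)$, choosing a uniformly random $k$-subset $S\subseteq[n]$ and adding every edge inside $S$. $\mathcal{D}_k=\tfrac12 G(n,\tfrac12)+\tfrac12 G(n,\tfrac12,k)$ is the balanced mixture. The clique complex $X(G)$ is the simplicial complex whose $d$-simplices are the $(d+1)$-cliques of $G$. The $d$-skeleton $\mathrm{skel}_d X(G)$ keeps exactly the faces of dimension $\le d$. $\beta_d(K)=\dim H_d(K;\mathbb{R})$. An estimate $\widehat\beta\in\mathbb{R}$ of $\beta_d$ has additive error below $\eta$ if $|\widehat\beta-\beta_d|<\eta$. Success means the output satisfies this. Polynomial time means time $\mathrm{poly}(n)$;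 the input graph is given explicitly. Classical planted-clique conjecture (PC): for every $k=k(n)$ with $(2+\varepsilon)\log_2 n\le k\le n^{1/2-\varepsilon}$ and every constant $\delta>0$, no randomized polynomial-time classical algorithm (knowing $n$ and $k$) distinguishes $G(n,\tfrac12)$ from $G(n,\tfrac12,k)$ with advantage $\ge\delta$, where the advantage is the absolute difference between the probabilities of outputting ''planted'' under the two distributions. Quantum planted-clique conjecture (qPC): the same statement with ''quantum polynomial-time algorithm'' in place of ''randomized polynomial-time classical algorithm''. Throughout, ''no algorithm achieves probability (or advantage) at least $q$'' means that no algorithm achieves this for all sufficiently large $n$. *)

(* Defs.v *)
From HB Require Import structures.
From mathcomp Require Import all_boot all_order all_algebra.
From mathcomp Require Import complex.
From mathcomp Require Import boolp classical_sets filter reals topology.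
From mathcomp Require Import normedtype sequences exp.
(* Imported last so that set0 is the empty finite set. *)
From mathcomp Require Import finset.

Set Implicit Arguments.
Unset Strict Implicit.
Unset Printing Implicit Defensive.

Import Order.TTheory GRing.Theory Num.Theory.

Local Open Scope ring_scope.

(* ------------------------------ Graphs ---------------------------------- *)

(* The vertex set [n] is 'I_n; a simple graph is its set of edges. *)
Definition edge (n : nat) : finType := {e : {set 'I_n} | #|e| == 2}.
Definition graph (n : nat) : finType := {set edge n}.

Definition adj n (G : graph n) (i j : 'I_n) : bool :=
  [exists e in G, val e == [set i; j]].

Definition is_clique n (G : graph n) (s : {set 'I_n}) : bool :=
  [forall i in s, forall j in s, (i != j) ==> adj G i j].

Definition plant n (S : {set 'I_n}) (G : graph n) : graph n :=
  G :|: [set e : edge n | val e \subset S].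

(* ------------------ Simplicial complexes and homology -------------------- *)

(* A complex on 'I_n is the set of its (nonempty) simplices; a simplex of
   dimension d has d + 1 vertices. *)
Definition clique_complex n (G : graph n) : {set {set 'I_n}} :=
  [set s : {set 'I_n} | (s != set0) && is_clique G s].

Definition skel n (d : nat) (K : {set {set 'I_n}}) : {set {set 'I_n}} :=
  [set s in K | (#|s| <= d.+1)%N].

Section Homology.
Variables (R : fieldType) (n : nat).

(* Real chains; the coefficient at s refers to the simplex s oriented by the
   increasing order of its vertices. *)
Definition chain := {ffun {set 'I_n} -> R^o}.

(* The coefficient of t in the boundary of t + v is (-1)^j, where j is the
   rank of v among the vertices of t + v.  The empty set is not a simplex, so
   that vertices have zero boundary and the homology is not reduced. *)
Definition boundary (c : chain) : chain :=
  [ffun t : {set 'I_n} =>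
    if t == set0 then 0
    else \sum_(v : 'I_n | v \notin t)
           (-1) ^+ #|[set u in t | (u < v)%N]| * c (v |: t)].

Fact boundary_is_linear : linear boundary.
Proof.
move=> a c c'; apply/ffunP => t; rewrite !ffunE.
case: (t == set0); first by rewrite scaler0 addr0.
rewrite scaler_sumr -big_split /=; apply: eq_bigr => v _.
by rewrite !ffunE mulrDr; congr (_ + _); rewrite /GRing.scale /= mulrCA.
Qed.

HB.instance Definition _ :=
  GRing.isLinear.Build R chain chain *:%R boundary boundary_is_linear.

Variable K : {set {set 'I_n}}.

Definition simplex_chain (s : {set 'I_n}) : chain := [ffun t => (t == s)%:R].

Definition chains (d : nat) : {vspace chain} :=
  <<[seq simplex_chain s | s <- enum [set s in K | #|s| == d.+1]]>>%VS.

Definition cycles (d : nat) : {vspace chain} :=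
  (chains d :&: lker (linfun boundary))%VS.

Definition boundaries (d : nat) : {vspace chain} :=
  (linfun boundary @: chains d.+1)%VS.

(* dim H_d(K; R), the dimension of the quotient of the cycles by the
   boundaries. *)
Definition betti (d : nat) : nat := (\dim (cycles d) - \dim (boundaries d))%N.

End Homology.

(* ---------------------------- Random graphs ------------------------------ *)

Section RandomGraphs.
Variables (R : realType) (n : nat).

Definition gnp_weight (p : R) (G : graph n) : R :=
  \prod_(e : edge n) (if e \in G then p else 1 - p).

(* Expectations of f under G(n,1/2), G(n,1/2,k) and D_k. *)
Definition expect_null (f : graph n -> R) : R :=
  \sum_(G : graph n) gnp_weight 2^-1 G * f G.

Definition expect_planted (k : nat) (f : graph n -> R) : R :=
  \sum_(S : {set 'I_n} | #|S| == k)
    'C(n, k)%:R^-1 * expect_null (fun G => f (plant S G)).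

Definition expect_mixture (k : nat) (f : graph n -> R) : R :=
  2^-1 * expect_null f + 2^-1 * expect_planted k f.

End RandomGraphs.

(* --------------------- Deterministic polynomial time --------------------- *)

(* Programs acting on finitely many stacks of bits, every elementary step
   having unit cost.  A stack is half a Turing machine tape and a program is
   a finite control, so that this is the multitape Turing machine model up to
   constant factors. *)
Inductive cmd :=
  | Skip
  | Push of nat & bool
  | Pop of nat
  | Seq of cmd & cmd
  | Case of nat & cmd & cmd & cmd  (* stack empty / top is 0 / top is 1 *)
  | While of nat & cmd.            (* while the stack is not empty *)

Definition store := nat -> seq bool.

Definition upd (s : store) (i : nat) (w : seq bool) : store :=
  fun j => if j == i then w else s j.

(* [exec c s t s'] : from s, the program c halts in s' after t steps. *)
Inductive exec : cmd -> store -> nat -> store -> Prop :=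
  | ExecSkip s : exec Skip s 1 s
  | ExecPush s i b : exec (Push i b) s 1 (upd s i (b :: s i))
  | ExecPop s i : exec (Pop i) s 1 (upd s i (behead (s i)))
  | ExecSeq c1 c2 s s1 s2 t1 t2 :
      exec c1 s t1 s1 -> exec c2 s1 t2 s2 ->
      exec (Seq c1 c2) s (t1 + t2) s2
  | ExecCase i c_empty c0 c1 s s' t :
      exec (match s i with
            | [::] => c_empty
            | false :: _ => c0
            | true :: _ => c1
            end) s t s' ->
      exec (Case i c_empty c0 c1) s t.+1 s'
  | ExecWhileEmpty i c s :
      s i = [::] -> exec (While i c) s 1 s
  | ExecWhileStep i c s s1 s2 t1 t2 :
      s i <> [::] -> exec c s t1 s1 -> exec (While i c) s1 t2 s2 ->
      exec (While i c) s (t1 + t2).+1 s2.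

Definition init_store (x y : seq bool) : store :=
  fun i => match i with 0 => x | 1 => y | _ => [::] end.

(* Every polynomial is dominated by one of these. *)
Definition poly_bound (a m : nat) : nat := (m ^ a + a)%N.

(* f (x, y) is computable in polynomial time: the inputs are on stacks 0 and
   1, the output is left on stack 0. *)
Definition ptime (f : seq bool -> seq bool -> seq bool) : Prop :=
  exists (c : cmd) (a : nat), forall x y : seq bool,
    exists (t : nat) (s : store),
      [/\ exec c (init_store x y) t s,
          (t <= poly_bound a (size x + size y))%N
        & s 0%N = f x y].

(* ------------------ Randomized and quantum algorithms -------------------- *)

(* The input-output behaviour of an algorithm: [A x E] is the probability that
   its output on x satisfies E. *)
Definition algorithm (R : realType) := seq bool -> pred (seq bool) -> R.

(* The fair coins are on a random tape r of polynomial length. *)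
Definition randomized_ptime (R : realType) (A : algorithm R) : Prop :=
  exists (f : seq bool -> seq bool -> seq bool) (a : nat), ptime f /\
    forall (x : seq bool) (E : pred (seq bool)),
      A x E = \sum_(r : (poly_bound a (size x)).-tuple bool | E (f x r))
                (2 ^+ poly_bound a (size x))^-1.

Inductive gate := Hadamard of nat | PhaseT of nat | CNot of nat & nat.

Section Circuits.
Variables (R : realType) (m : nat).

(* Amplitudes of a state of m qubits in the computational basis. *)
Definition qstate := m.-tuple bool -> R[i].

Definition qbit (x : m.-tuple bool) (i : nat) : bool := nth false x i.

Definition set_qbit (x : m.-tuple bool) (i : nat) (b : bool) : m.-tuple bool :=
  [tuple (if val j == i then b else tnth x j) | j < m].

Definition inv_sqrt2 : R := (Num.sqrt 2)^-1.

(* A gate whose qubits do not exist or coincide is ignored. *)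
Definition apply_gate (psi : qstate) (g : gate) : qstate :=
  match g with
  | Hadamard i =>
      if (i < m)%N then fun x =>
        Complex inv_sqrt2 0 *
          (psi (set_qbit x i false) + (-1) ^+ qbit x i * psi (set_qbit x i true))
      else psi
  | PhaseT i => (* phase exp(i pi / 4) *)
      if (i < m)%N then fun x =>
        (if qbit x i then Complex inv_sqrt2 inv_sqrt2 else 1) * psi x
      else psi
  | CNot i j => (* control i, target j *)
      if [&& (i < m)%N, (j < m)%N & i != j] then fun x =>
        psi (set_qbit x j (qbit x j (+) qbit x i))
      else psi
  end.

Definition zero_state : qstate := fun x => (x == [tuple false | _ < m])%:R.

(* Probability of reading y when all the qubits are measured at the end. *)
Definition outcome_prob (gs : seq gate) (y : m.-tuple bool) : R :=
  let z := foldl apply_gate zero_state gs y in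
  complex.Re z ^+ 2 + complex.Im z ^+ 2.

End Circuits.

(* Binary descriptions of circuits.  Numbers are in unary, 1^i 0; a circuit is
   its number of qubits followed by its gates; the gates have the prefixes
   00 (Hadamard), 01 (T) and 1 (CNOT), followed by the indices of the qubits. *)
Fixpoint read_unary (w : seq bool) : nat * seq bool :=
  match w with
  | true :: w' => let: (i, w'') := read_unary w' in (i.+1, w'')
  | false :: w' => (0%N, w')
  | [::] => (0%N, [::])
  end.

Fixpoint read_gates (fuel : nat) (w : seq bool) : seq gate :=
  match fuel, w with
  | fuel'.+1, true :: w1 =>
      let: (i, w2) := read_unary w1 in
      let: (j, w3) := read_unary w2 in
      CNot i j :: read_gates fuel' w3
  | fuel'.+1, false :: false :: w1 =>
      let: (i, w2) := read_unary w1 in Hadamard i :: read_gates fuel' w2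
  | fuel'.+1, false :: true :: w1 =>
      let: (i, w2) := read_unary w1 in PhaseT i :: read_gates fuel' w2
  | _, _ => [::]
  end.

Definition circuit_width (w : seq bool) : nat := (read_unary w).1.
Definition circuit_gates (w : seq bool) : seq gate :=
  read_gates (size w) (read_unary w).2.

(* A classical polynomial-time program writes a circuit c(x) over the
   universal gate set {H, T, CNOT}, which is run on the zero state and
   measured; the output is computed from x and the measured string y by
   classical polynomial-time post-processing. *)
Definition quantum_ptime (R : realType) (A : algorithm R) : Prop :=
  exists c f : seq bool -> seq bool -> seq bool, ptime c /\ ptime f /\
    forall (x : seq bool) (E : pred (seq bool)),
      let w := c x [::] in
      A x E = \sum_(y : (circuit_width w).-tuple bool | E (f x y))
                outcome_prob R (circuit_gates w) y.

(* ------------------------ Inputs and outputs ----------------------------- *)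

Definition unary (i : nat) : seq bool := rcons (nseq i true) false.

(* The input (G, m), with m <= n a parameter: m, n and the adjacency matrix. *)
Definition encode n (G : graph n) (m : nat) : seq bool :=
  unary m ++ unary n ++ [seq adj G i j | i <- enum 'I_n, j <- enum 'I_n].

(* Output "planted" of a distinguisher. *)
Definition says_planted (w : seq bool) : bool := head false w.

(* Binary numerals, least significant bit first. *)
Definition num_of_bits (w : seq bool) : nat :=
  foldr (fun (b : bool) m => (b + m.*2)%N) 0%N w.

Fixpoint unzip_bits (w : seq bool) : seq bool * seq bool :=
  match w with
  | p :: q :: w' => let: (ps, qs) := unzip_bits w' in (p :: ps, q :: qs)
  | [:: p] => ([:: p], [::])
  | [::] => ([::], [::])
  end.

(* The rational number output by an estimator: a sign bit followed by the
   interleaved bits of p and q stands for p / (q + 1) or - p / (q + 1). *)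
Definition estimate (R : realType) (w : seq bool) : R :=
  let: (ps, qs) := unzip_bits (behead w) in
  (-1) ^+ head false w * (num_of_bits ps)%:R / (num_of_bits qs).+1%:R.

(* --------------- Conjectures and estimation guarantee -------------------- *)

Local Open Scope classical_set_scope.
Local Open Scope ring_scope.

Definition log2 (R : realType) (n : nat) : R := ln n%:R / ln 2.

(* No algorithm of the given class distinguishes G(n,1/2) from G(n,1/2,k) with
   constant advantage for all sufficiently large n. *)
Definition planted_clique_conjecture (R : realType)
    (class : algorithm R -> Prop) (eps : R) : Prop :=
  forall k : nat -> nat,
    (\forall n \near \oo,
       (2 + eps) * log2 R n <= (k n)%:R <= n%:R `^ (2^-1 - eps)) ->
  forall delta : R, 0 < delta ->
  ~ exists A : algorithm R, class A /\
      \forall n \near \oo,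
        let accept (G : graph n) := A (encode G (k n)) says_planted in
        delta <= `|expect_null accept - expect_planted (k n) accept|.

Definition PC (R : realType) (eps : R) : Prop :=
  planted_clique_conjecture (@randomized_ptime R) eps.

Definition qPC (R : realType) (eps : R) : Prop :=
  planted_clique_conjecture (@quantum_ptime R) eps.

(* Probability over G ~ D_k and the internal randomness of A that A, given G
   and d, estimates the d-th Betti number of the d-skeleton of X(G) to
   additive error below eta. *)
Definition success_prob (R : realType) (A : algorithm R) (n k d : nat)
    (eta : R) : R :=
  expect_mixture k (fun G : graph n =>
    A (encode G d) (fun w =>
      `|estimate R w - (betti R (skel d (clique_complex G)) d)%:R| < eta)).

Definition estimates_betti (R : realType) (A : algorithm R) (k : nat -> nat)
    (delta : R) : Prop :=
  \forall n \near \oo,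
    2^-1 + delta <= success_prob A n (k n) (k n - 2) 2^-1.

(* Main.v *)
(* In the d-skeleton there are no (d+1)-simplices, so its d-th Betti number is
   the dimension of the space of d-cycles.  With d = k - 2, the boundary of a
   planted k-clique is a nonzero d-cycle, whereas by the first moment method
   G(n,1/2) has with high probability no (k-1)-clique, hence no d-chain at all,
   because k > (2 + eps) log2 n.  Rounding an estimate of the Betti number
   therefore tells the two distributions apart with an advantage of at least
   2 delta - o(1).

   The rounded estimator has to be exhibited as an algorithm of the same class:
   the parameter k becomes k - 2 by dropping two bits of its unary code; the
   random tape, whose length is dictated by the longer input, is truncated by a
   program that counts up to a polynomial; and the output, a fraction with
   interleaved binary numerals, is compared with 1/2 in one pass. *)
Require Import Defs.
From mathcomp Require Import all_boot all_order all_algebra zify ring lra.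
From mathcomp Require Import complex.
From mathcomp Require Import boolp classical_sets filter reals topology.
From mathcomp Require Import normedtype sequences exp.
(* Imported last so that set0 is the empty finite set. *)
From mathcomp Require Import finset.

Set Implicit Arguments.
Unset Strict Implicit.
Unset Printing Implicit Defensive.

Import Order.TTheory GRing.Theory Num.Theory.

(** * Stack programs *)

Definition poly_dominated (T : nat -> nat) : Prop :=
  exists a, forall m, T m <= poly_bound a m.

Lemma leq_poly_bound a m m' : m <= m' -> poly_bound a m <= poly_bound a m'.
Proof.
move=> mm'; rewrite leq_add2r; case: a => [|a]; first by rewrite !expn0.
by rewrite leq_exp2r.
Qed.

Lemma poly_dominated_le (T T' : nat -> nat) :
  (forall m, T m <= T' m) -> poly_dominated T' -> poly_dominated T.
Proof. by move=> TT' [a Ta]; exists a => m; apply: leq_trans (Ta m). Qed.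

Lemma leq_exp0 a : 0 ^ a <= 1.
Proof. by case: a => [|a] //; rewrite exp0n. Qed.

Lemma poly_dominated_monomial c a : poly_dominated (fun m => c * m ^ a).
Proof.
(* For m >= 2 the coefficient is absorbed by m ^ c >= 2 ^ c > c; the additive constant of
   [poly_bound] covers m = 0 and m = 1. *)
exists (a + c) => -[|[|m]]; rewrite /poly_bound.
- by apply: leq_trans _ (leq_addl _ _); have := leq_exp0 a; nia.
- by rewrite !exp1n; lia.
- rewrite expnD mulnC (leq_trans _ (leq_addr _ _)) // leq_mul2l.
  apply/orP; right; apply: (leq_trans (ltnW (ltn_expl c (isT : 1 < 2)))).
  by case: c => [|c] //; rewrite leq_exp2r.
Qed.

Lemma poly_dominatedD T1 T2 : poly_dominated T1 -> poly_dominated T2 ->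
  poly_dominated (fun m => T1 m + T2 m).
Proof.
(* The extra 2 in the exponent gives a factor m ^ 2 >= 4 for m >= 2, enough for the two leading
   powers; in the additive constant it pays for 0 ^ a + 0 ^ b. *)
move=> [a Ta] [b Tb]; exists (a + b + 2) => m.
apply: leq_trans (leq_add (Ta m) (Tb m)) _; rewrite /poly_bound.
case: m => [|[|m]].
- apply: leq_trans _ (leq_addl _ _).
  by have := leq_exp0 a; have := leq_exp0 b; lia.
- by rewrite !exp1n; lia.
- have h e e' : e <= e' -> m.+2 ^ e <= m.+2 ^ e' by move=> ?; rewrite leq_exp2l.
  have := h a (a + b) (leq_addr _ _); have := h b (a + b) (leq_addl _ _).
  by rewrite (expnD _ (a + b) 2); nia.
Qed.

Lemma poly_dominated_cst c : poly_dominated (fun=> c).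
Proof.
by apply: poly_dominated_le (poly_dominated_monomial c 0) => m; rewrite muln1.
Qed.

Lemma poly_dominated_id : poly_dominated id.
Proof.
by apply: poly_dominated_le (poly_dominated_monomial 1 1) => m; rewrite mul1n.
Qed.

Lemma poly_dominatedM T1 T2 : poly_dominated T1 -> poly_dominated T2 ->
  poly_dominated (fun m => T1 m * T2 m).
Proof.
move=> [a Ta] [b Tb].
apply: (@poly_dominated_le _ (fun m =>
  (1 * m ^ (a + b) + a * m ^ b) + (b * m ^ a + (a * b) * m ^ 0))).
  move=> m; apply: leq_trans (leq_mul (Ta m) (Tb m)) _.
  by rewrite /poly_bound expnD expn0; nia.
by do 2!apply: poly_dominatedD; exact: poly_dominated_monomial.
Qed.

(** * Executions with upper bounds on their running time *)

Definition runs (c : cmd) (s : store) (T : nat) (s' : store) : Prop :=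
  exists2 t, t <= T & exec c s t s'.

Lemma runs_le c s T T' s' : T <= T' -> runs c s T s' -> runs c s T' s'.
Proof. by move=> TT' [t tT e]; exists t => //; apply: leq_trans TT'. Qed.

Lemma runs_skip s : runs Skip s 1 s.
Proof. by exists 1; last exact: ExecSkip. Qed.

Lemma runs_push s i b : runs (Push i b) s 1 (upd s i (b :: s i)).
Proof. by exists 1; last exact: ExecPush. Qed.

Lemma runs_pop s i : runs (Pop i) s 1 (upd s i (behead (s i))).
Proof. by exists 1; last exact: ExecPop. Qed.

Lemma runs_seq c1 c2 s s1 s2 T1 T2 :
  runs c1 s T1 s1 -> runs c2 s1 T2 s2 -> runs (Seq c1 c2) s (T1 + T2) s2.
Proof.
move=> [t1 t1T e1] [t2 t2T e2]; exists (t1 + t2); first exact: leq_add.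
exact: ExecSeq e1 e2.
Qed.

Lemma runs_case i c_empty c0 c1 s T s' :
  runs (match s i with
        | [::] => c_empty | false :: _ => c0 | true :: _ => c1
        end) s T s' ->
  runs (Case i c_empty c0 c1) s T.+1 s'.
Proof. by move=> [t tT e]; exists t.+1; last exact: ExecCase. Qed.

Lemma runs_if i c0 c1 s T s' :
  runs (if head false (s i) then c1 else c0) s T s' ->
  runs (Case i c0 c0 c1) s T.+1 s'.
Proof. by move=> h; apply: runs_case; case: (s i) h => [|[]]. Qed.

Lemma runs_while_nil i c s : s i = [::] -> runs (While i c) s 1 s.
Proof. by exists 1; last exact: ExecWhileEmpty. Qed.

Lemma runs_while_step i c s s1 s2 T1 T2 :
  s i <> [::] -> runs c s T1 s1 -> runs (While i c) s1 T2 s2 ->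
  runs (While i c) s (T1 + T2).+1 s2.
Proof.
move=> si [t1 t1T e1] [t2 t2T e2]; exists (t1 + t2).+1.
  by rewrite ltnS leq_add.
exact: ExecWhileStep e1 e2.
Qed.

Lemma runs_ext c s T s1 s2 : s1 =1 s2 -> runs c s T s1 -> runs c s T s2.
Proof. by move=> /funext ->. Qed.

Lemma upd_same s i w : upd s i w i = w.
Proof. by rewrite /upd eqxx. Qed.

Lemma upd_id s i : upd s i (s i) = s.
Proof. by apply/funext => j; rewrite /upd; case: eqP => // ->. Qed.

Lemma upd_upd s i v w : upd (upd s i v) i w = upd s i w.
Proof. by apply/funext => j; rewrite /upd; case: eqP. Qed.

Lemma updC s i j v w : i != j -> upd (upd s i v) j w = upd (upd s j w) i v.
Proof.
move=> ij; apply/funext => l; rewrite /upd.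
by case: (l =P j) => [->|//]; rewrite eq_sym (negbTE ij).
Qed.

Lemma upd_other s i j w : j != i -> upd s i w j = s j.
Proof. by move=> ji; rewrite /upd (negbTE ji). Qed.

(** A step pushes at most one bit. This bounds the size of an intermediate output by the time taken
    to produce it. *)
Lemma exec_size c s t s' :
  exec c s t s' -> forall i, size (s' i) <= size (s i) + t.
Proof.
elim => {c s t s'} [s|s i b|s i|c1 c2 s s1 s2 t1 t2 _ h1 _ h2
  |i ce c0 c1 s s' t _ h|i c s _|i c s s1 s2 t1 t2 _ _ h1 _ h2] j.
- by rewrite leq_addr.
- by rewrite /upd; case: eqP => [->|_] /=; lia.
- by rewrite /upd; case: eqP => [->|_]; rewrite ?size_behead; lia.
- by have := h1 j; have := h2 j; lia.
- by have := h j; lia.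
- by rewrite leq_addr.
- by have := h1 j; have := h2 j; lia.
Qed.

Definition clear (i : nat) : cmd := While i (Pop i).

Lemma runs_clear i s : runs (clear i) s (2 * size (s i) + 1) (upd s i [::]).
Proof.
move: {2}(s i) (erefl (s i)) => w; elim: w s => [|b w IH] s si.
  by rewrite -si upd_id si; apply: runs_while_nil.
have := IH (upd s i (behead (s i))); rewrite upd_same upd_upd si => /(_ erefl) h.
apply: runs_le (runs_while_step _ (runs_pop s i) _); rewrite ?si //=; last exact: h.
by rewrite /=; lia.
Qed.

Definition move_bits (i j : nat) : cmd :=
  While i (Case i Skip (Seq (Push j false) (Pop i)) (Seq (Push j true) (Pop i))).

Lemma runs_move_bits i j s : i != j ->
  runs (move_bits i j) s (4 * size (s i) + 1)
    (upd (upd s i [::]) j (catrev (s i) (s j))).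
Proof.
move=> ij; have ji : j != i by rewrite eq_sym.
move: {2}(s i) (erefl (s i)) => w; elim: w s => [|b w IH] s si.
  rewrite si /= -si !upd_id; exact: runs_while_nil.
pose s1 := upd (upd s j (b :: s j)) i w.
have step : runs (Case i Skip (Seq (Push j false) (Pop i))
    (Seq (Push j true) (Pop i))) s 3 s1.
  apply: runs_case; rewrite si; have := runs_seq (runs_push s j b)
    (runs_pop (upd s j (b :: s j)) i).
  by rewrite upd_other // si; case: b @s1 {si}.
have s1i : s1 i = w by rewrite /s1 upd_same.
apply: runs_le (runs_while_step _ step _); rewrite ?si //; last first.
  have := IH _ s1i; rewrite s1i /s1 => h.
  apply: runs_ext h => l; rewrite /= /upd (negbTE ji).
  by case: eqP => // _; case: eqP.
by rewrite /=; lia.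
Qed.

(** Each pass reverses the order of the bits, so going through the auxiliary stack [l] restores it,
    and stack [i] is rebuilt while [j] is filled. *)
Definition copy_bits (i j l : nat) : cmd :=
  Seq (move_bits i l)
    (While l (Case l Skip
       (Seq (Push i false) (Seq (Push j false) (Pop l)))
       (Seq (Push i true) (Seq (Push j true) (Pop l))))).

Lemma runs_copy_bits i j l s : i != j -> i != l -> j != l ->
  s j = [::] -> s l = [::] ->
  runs (copy_bits i j l) s (9 * size (s i) + 2) (upd s j (s i)).
Proof.
move=> ij il jl sj sl.
have back w s1 : s1 l = w ->
    runs (While l (Case l Skip
       (Seq (Push i false) (Seq (Push j false) (Pop l)))
       (Seq (Push i true) (Seq (Push j true) (Pop l))))) s1 (5 * size w + 1)
      (upd (upd (upd s1 l [::]) i (catrev w (s1 i))) j (catrev w (s1 j))).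
  elim: w s1 => [|b w IH] s1 s1l.
    rewrite /= -s1l !upd_id; exact: runs_while_nil.
  pose s2 := upd (upd (upd s1 i (b :: s1 i)) j (b :: s1 j)) l w.
  have step : runs (Case l Skip
       (Seq (Push i false) (Seq (Push j false) (Pop l)))
       (Seq (Push i true) (Seq (Push j true) (Pop l)))) s1 4 s2.
    apply: runs_case; rewrite s1l; set s3 := upd s1 i (b :: s1 i).
    have := runs_seq (runs_push s1 i b) (runs_seq (runs_push s3 j b)
      (runs_pop (upd s3 j (b :: s3 j)) l)).
    rewrite /s3 (@upd_other _ j l) 1?eq_sym // (@upd_other _ i l) 1?eq_sym //.
    rewrite (@upd_other _ i j) 1?eq_sym // s1l.
    by case: b @s2 {s1l} @s3.
  apply: runs_le (runs_while_step _ step _); rewrite ?s1l //; last first.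
    apply: runs_ext (IH s2 (upd_same _ _ _)) => m; rewrite /s2 /= /upd.
    rewrite eqxx (negbTE ij) (negbTE il) eqxx (negbTE jl).
    by do 3!case: eqP => // _.
  by rewrite /=; lia.
have := runs_seq (runs_move_bits s il) (back _ _ (erefl _)).
rewrite !upd_same (@upd_other _ l i) // (@upd_other _ l j) //.
rewrite (@upd_other _ i j) 1?eq_sym // upd_same sj sl !catrevE !cats0 revK.
move=> h; apply: runs_le (runs_ext _ h); first by rewrite size_rev; lia.
move=> m; rewrite /upd; case: eqP => // _.
by case: (m =P i) => [->|_] //; case: eqP => [->|].
Qed.

(** The program of [f] is specified only on initial stores, so [p] must leave all work stacks empty.
    The inputs do not grow, so the time bound of [f] at the original size still applies. *)
Lemma ptime_precomp (f : seq bool -> seq bool -> seq bool)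
    (h1 h2 : seq bool -> seq bool -> seq bool) (p : cmd) (T : nat -> nat) :
  (forall x y, size (h1 x y) + size (h2 x y) <= size x + size y) ->
  poly_dominated T ->
  (forall x y, runs p (init_store x y) (T (size x + size y))
                 (init_store (h1 x y) (h2 x y))) ->
  ptime f -> ptime (fun x y => f (h1 x y) (h2 x y)).
Proof.
move=> hsize Tpoly hp [c [a hc]].
have [b hb] : poly_dominated (fun m => T m + poly_bound a m).
  by apply: poly_dominatedD => //; exists a.
exists (Seq p c), b => x y.
have [t [s [ec ta s0]]] := hc (h1 x y) (h2 x y).
have [t' t'T ep] := hp x y.
exists (t' + t), s; split => //; first exact: ExecSeq ep ec.
apply: leq_trans (hb _); apply: leq_add => //.
exact: leq_trans ta (leq_poly_bound _ _).
Qed.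

(** The program of [f] may leave anything on the stacks other than 0, so [q] has to work from every
    store. *)
Lemma ptime_postcomp (f : seq bool -> seq bool -> seq bool)
    (g : seq bool -> seq bool) (q : cmd) (T : nat -> nat) :
  poly_dominated T -> {homo T : m n / m <= n} ->
  (forall s, exists2 s', runs q s (T (size (s 0))) s' & s' 0 = g (s 0)) ->
  ptime f -> ptime (fun x y => g (f x y)).
Proof.
move=> [b Tb] Tmono hq [c [a hc]].
(* By [exec_size] the output of [f] has at most m + [poly_bound a m] bits, and this is the size on
   which [q] runs. *)
have [e he] : poly_dominated (fun m => poly_bound a m +
    ((m + poly_bound a m) ^ b + b)).
  have pa : poly_dominated (poly_bound a) by exists a.
  apply: poly_dominatedD => //; apply: poly_dominatedD; last first.
    exact: poly_dominated_cst.
  elim: b {Tb} => [|b IH]; first exact: poly_dominated_cst.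
  apply: (@poly_dominated_le _ (fun m =>
    (m + poly_bound a m) * (m + poly_bound a m) ^ b)) => [m|].
    by rewrite expnS.
  apply: poly_dominatedM => //; apply: poly_dominatedD => //.
  exact: poly_dominated_id.
exists (Seq c q), e => x y; have [t [s [ec ta <-]]] := hc x y.
have [s' [t' t'T eq] <-] := hq s; exists (t + t'), s'; split => //.
  exact: ExecSeq ec eq.
apply: leq_trans (he _); apply: leq_add => //.
apply: leq_trans t'T (leq_trans (Tmono _ _ _) (Tb _)).
by have := exec_size ec 0; rewrite /=; lia.
Qed.

Lemma ptime_drop2 (f : seq bool -> seq bool -> seq bool) :
  ptime f -> ptime (fun x y => f (drop 2 x) y).
Proof.
apply: (@ptime_precomp f (fun x _ => drop 2 x) (fun _ y => y)
  (Seq (Pop 0) (Pop 0)) (fun=> 2)) => [x y||x y].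
- by rewrite size_drop; lia.
- exact: poly_dominated_cst.
- apply: runs_ext (runs_seq (runs_pop _ _) (runs_pop _ _)) => -[|[|j]] //=.
  by case: x => [|a [|b x]] //=; rewrite drop0.
Qed.

(** * Truncating the random tape to a polynomial length *)

Definition shift_bit : cmd :=
  Case 1 Skip (Seq (Push 2 false) (Pop 1)) (Seq (Push 2 true) (Pop 1)).

Definition shifted (s : store) : store :=
  if s 1 is b :: y then upd (upd s 2 (b :: s 2)) 1 y else s.

Lemma runs_shift_bit s : runs shift_bit s 3 (shifted s).
Proof.
apply: runs_case; rewrite /shifted; case s1 : (s 1) => [|b y].
  by apply: runs_le (runs_skip s).
have := runs_seq (runs_push s 2 b) (runs_pop (upd s 2 (b :: s 2)) 1).
by rewrite upd_other // s1; case: b {s1}.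
Qed.

(** Shifting from an empty stack 1 does nothing, in agreement with [take] and [drop] past the end of
    a sequence. *)
Lemma iter_shifted N s : iter N shifted s =
  upd (upd s 2 (catrev (take N (s 1)) (s 2))) 1 (drop N (s 1)).
Proof.
elim: N s => [|N IH] s; first by rewrite take0 drop0 /= !upd_id.
rewrite iterSr IH /shifted; case s1 : (s 1) => [|b y] /=.
  by rewrite s1 /= -s1 !upd_id.
rewrite upd_same (@upd_other _ 1 2) // upd_same.
by apply/funext => j; rewrite /upd; case: eqP => // _; case: eqP.
Qed.

Lemma iter_shifted_upd N s j w : 2 < j ->
  iter N shifted (upd s j w) = upd (iter N shifted s) j w.
Proof.
move=> j2; have [j1' j2'] : j != 1 /\ j != 2 by lia.
rewrite !iter_shifted !(@upd_other _ j) 1?eq_sym //.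
by rewrite (@updC _ j 2) // (@updC _ j 1).
Qed.

Lemma iter_shifted_other N s j : j != 1 -> j != 2 -> iter N shifted s j = s j.
Proof. by move=> j1 j2; rewrite iter_shifted !upd_other. Qed.

(* With m the size of stack 0, shifts m ^ a bits by a nested loops over stack 0;
   stack 4 + a' holds the counter of a loop and stack 3 is used for copying. *)
Fixpoint shift_power (a : nat) : cmd :=
  if a is a'.+1 then
    Seq (copy_bits 0 (4 + a') 3)
        (While (4 + a') (Seq (Pop (4 + a')) (shift_power a')))
  else shift_bit.

Fixpoint shift_power_time (a m : nat) : nat :=
  if a is a'.+1 then
    (9 * m + 2) + (m * (shift_power_time a' m + 2) + 1)
  else 3.

Lemma poly_dominated_shift_power_time a : poly_dominated (shift_power_time a).
Proof.
elim: a => [|a IH]; first exact: poly_dominated_cst.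
have idp := poly_dominated_id; have cp := poly_dominated_cst.
apply: poly_dominatedD; apply: poly_dominatedD => //; apply: poly_dominatedM => //.
exact: poly_dominatedD.
Qed.

Lemma runs_shift_power a s : s 3 = [::] -> (forall j, j < a -> s (4 + j) = [::]) ->
  runs (shift_power a) s (shift_power_time a (size (s 0)))
    (iter (size (s 0) ^ a) shifted s).
Proof.
elim: a s => [|a IH] s s3 sa; first exact: runs_shift_bit.
have sa0 : s (4 + a) = [::] by apply: sa.
apply: runs_seq (runs_copy_bits _ _ _ _ _) _ => //.
(* The outer loop for an arbitrary counter [w]. Its invariants survive each round because shifting
   touches only stacks 1 and 2. *)
have loop w s1 : s1 3 = [::] -> (forall j, j < a -> s1 (4 + j) = [::]) ->
    size (s1 0) = size (s 0) ->
    runs (While (4 + a) (Seq (Pop (4 + a)) (shift_power a))) (upd s1 (4 + a) w)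
      (size w * (shift_power_time a (size (s 0)) + 2) + 1)
      (upd (iter (size w * size (s 0) ^ a) shifted s1) (4 + a) [::]).
  elim: w s1 => [|b w IHw] s1 s13 s1a s10.
    by apply: runs_while_nil; rewrite upd_same.
  set s2 := iter (size (s 0) ^ a) shifted s1.
  have step : runs (Seq (Pop (4 + a)) (shift_power a)) (upd s1 (4 + a) (b :: w))
      (1 + shift_power_time a (size (s 0))) (upd s2 (4 + a) w).
    apply: runs_seq (runs_pop _ _) _; rewrite upd_same upd_upd /=.
    have := IH (upd s1 (4 + a) w); rewrite iter_shifted_upd // [size _]s10.
    apply => // j ja; rewrite upd_other ?s1a //; lia.
  have s2E j : j != 1 -> j != 2 -> s2 j = s1 j by apply: iter_shifted_other.
  have tail : runs (While (4 + a) (Seq (Pop (4 + a)) (shift_power a)))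
      (upd s2 (4 + a) w) (size w * (shift_power_time a (size (s 0)) + 2) + 1)
      (upd (iter (size w * size (s 0) ^ a) shifted s2) (4 + a) [::]).
    apply: IHw; rewrite ?s2E // => j ja; rewrite s2E ?s1a //; lia.
  rewrite /s2 -iterD -mulSnr in tail.
  apply: runs_le (runs_while_step _ step tail); last by rewrite upd_same.
  by rewrite /=; lia.
have sa' j : j < a -> s (4 + j) = [::] by move=> ja; apply: sa; lia.
have := loop (s 0) s s3 sa' (erefl _); rewrite -expnS => h.
apply: runs_ext h => j; rewrite /upd; case: eqP => // ->.
by rewrite iter_shifted_other.
Qed.

Fixpoint repeat_cmd (a : nat) (c : cmd) : cmd :=
  if a is a'.+1 then Seq c (repeat_cmd a' c) else Skip.

Lemma runs_repeat_shift a s :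
  runs (repeat_cmd a shift_bit) s (3 * a + 1) (iter a shifted s).
Proof.
elim: a s => [|a IH] s; first exact: runs_skip.
rewrite iterSr; apply: runs_le (runs_seq (runs_shift_bit s) (IH _)); lia.
Qed.

(** With m the size of stack 0, the first two commands shift m ^ a and then a bits, in total
    [poly_bound a m]. The rest of stack 1 is erased and the kept bits, reversed on stack 2, are
    moved back into order. *)
Definition truncate (a : nat) : cmd :=
  Seq (shift_power a) (Seq (repeat_cmd a shift_bit)
    (Seq (clear 1) (move_bits 2 1))).

Lemma runs_truncate a x y :
  runs (truncate a) (init_store x y)
    (shift_power_time a (size x) + (3 * a + 1 + (2 * size y + 1 + (4 * size y + 1))))
    (init_store x (take (poly_bound a (size x)) y)).
Proof.
apply: runs_seq; first by apply: runs_shift_power => //.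
apply: runs_seq; first exact: runs_repeat_shift.
rewrite -iterD addnC -/(poly_bound _ _) iter_shifted.
set N := poly_bound _ _; set s := upd _ _ _.
have s1 : s 1 = drop N y by rewrite /s upd_same.
have s2 : s 2 = rev (take N y) by rewrite /s upd_other // upd_same catrevE cats0.
apply: runs_seq; first by apply: runs_le (runs_clear 1 s); rewrite s1 size_drop; lia.
have := @runs_move_bits 2 1 (upd s 1 [::]) isT.
rewrite upd_same upd_other // s2 catrevE cats0 revK size_rev => h.
apply: runs_le (runs_ext _ h) => [|[|[|[|j]]]] //.
by rewrite size_take; case: ltnP; lia.
Qed.

Lemma ptime_truncate (f : seq bool -> seq bool -> seq bool) (a : nat) :
  ptime f -> ptime (fun x y => f x (take (poly_bound a (size x)) y)).
Proof.
have mono m m' : m <= m' -> shift_power_time a m <= shift_power_time a m'.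
  by move=> mm'; elim: a => [|b IH] //=; nia.
apply: (@ptime_precomp f (fun x _ => x)
  (fun x y => take (poly_bound a (size x)) y) (truncate a)
  (fun m => shift_power_time a m + (6 * m + (3 * a + 3)))) => [x y||x y].
- by rewrite size_take; case: ltnP; lia.
- have idp := poly_dominated_id; have cp := poly_dominated_cst.
  apply: poly_dominatedD; first exact: poly_dominated_shift_power_time.
  by apply: poly_dominatedD => //; apply: poly_dominatedM.
- apply: runs_le (runs_truncate a x y).
  have := mono _ _ (leq_addr (size y) (size x)); lia.
Qed.

(** * Comparing a fraction with 1/2 in one pass *)

Fixpoint exceeds (acc prev : bool) (w : seq bool) : bool :=
  match w with
  | [::] => prev || acc
  | [:: p] => p || (if prev then true else acc)
  | p :: q :: w' => exceeds (if prev == q then acc else prev) p w'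
  end.

Lemma seq2_ind (T : Type) (P : seq T -> Prop) :
  P [::] -> (forall x, P [:: x]) -> (forall x y s, P s -> P [:: x, y & s]) ->
  forall s, P s.
Proof.
move=> P0 P1 P2 s; suff [] : P s /\ forall x, P (x :: s) by [].
by elim: s => [|y s [Ps IH]]; split => // x; apply: P2.
Qed.

(** Doubling the numerator delays its bits by one position, so each bit of q is compared with the
    preceding bit of p, kept in [prev]. Bits come least significant first: a difference overrides
    the verdict [acc] of the lower positions, and a tie keeps it. *)
Lemma exceedsE acc prev w :
  let: (ps, qs) := unzip_bits w in
  exceeds acc prev w = (num_of_bits qs < (num_of_bits ps).*2 + prev) ||
    acc && (num_of_bits qs == (num_of_bits ps).*2 + prev).
Proof.
elim/seq2_ind: w acc prev => [|p|p q w IH] acc prev /=.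
- by case: acc prev => [] [].
- by case: p acc prev => [] [] [].
- have := IH (if prev == q then acc else prev) p.
  case: (unzip_bits w) => ps qs -> /=.
  set P := num_of_bits ps; set Q := num_of_bits qs.
  by case: prev; case: q; case: p; case: acc => /=; lia.
Qed.

(* p / (q + 1) > 1/2 means 2 p > q + 1; the test 2 p > q differs from it only
   when the estimate is exactly 1/2. *)
Definition round_up (w : seq bool) : bool :=
  ~~ head false w && exceeds false false (behead w).

(** Registers are overwritten by pushing: only the tops of stacks 1 and 2 are ever read, and older
    values stay underneath. *)
Definition set_acc (q : bool) : cmd :=
  if q then Case 1 (Push 2 false) (Push 2 false) Skip
  else Case 1 Skip Skip (Push 2 true).

Definition after_q (p q : bool) : cmd := Seq (set_acc q) (Push 1 p).

(** A word of odd length lacks its last bit of q, which is read as 0; this agrees with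
    [unzip_bits]. *)
Definition read_q (p : bool) : cmd :=
  Seq (Pop 0) (Case 0 (after_q p false) (Seq (Pop 0) (after_q p false))
                 (Seq (Pop 0) (after_q p true))).

Definition read_pair : cmd := Case 0 Skip (read_q false) (read_q true).

(* The bits prev and acc are the tops of stacks 1 and 2. *)
Definition threshold : cmd :=
  Seq (Push 1 false) (Seq (Push 2 false)
    (Seq (Case 0 Skip (Pop 0) (clear 0))
      (Seq (While 0 read_pair)
        (Case 1 (Case 2 (Push 0 false) (Push 0 false) (Push 0 true))
                (Case 2 (Push 0 false) (Push 0 false) (Push 0 true))
                (Push 0 true))))).

Lemma runs_after_q p q s : exists s', [/\ runs (after_q p q) s 3 s',
  s' 0 = s 0, head false (s' 1) = p &
  head false (s' 2) =
    if head false (s 1) == q then head false (s 2) else head false (s 1)].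
Proof.
rewrite /after_q /set_acc; case: q.
- pose s1 := if head false (s 1) then s else upd s 2 (false :: s 2).
  exists (upd s1 1 (p :: s1 1)); split => //; last 1 first.
  + by rewrite /s1 /upd /=; case: (head _ (s 1)).
  + apply: (@runs_seq _ _ _ s1 _ 2 1) (runs_push _ _ _); apply: runs_if; rewrite /s1.
    by case: (head _ (s 1)); [exact: runs_skip | exact: runs_push].
  + by rewrite /s1 /upd /=; case: (head _ (s 1)).
- pose s1 := if head false (s 1) then upd s 2 (true :: s 2) else s.
  exists (upd s1 1 (p :: s1 1)); split => //; last 1 first.
  + by rewrite /s1 /upd /=; case: (head _ (s 1)).
  + apply: (@runs_seq _ _ _ s1 _ 2 1) (runs_push _ _ _); apply: runs_if; rewrite /s1.
    by case: (head _ (s 1)); [exact: runs_push | exact: runs_skip].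
  + by rewrite /s1 /upd /=; case: (head _ (s 1)).
Qed.

Lemma runs_read_pair s p w : s 0 = p :: w ->
  exists s', [/\ runs read_pair s 7 s', s' 0 = behead w, head false (s' 1) = p &
  head false (s' 2) = if head false (s 1) == head false w
                      then head false (s 2) else head false (s 1)].
Proof.
move=> s0; pose s1 := upd s 0 w.
have pop1 : runs (Pop 0) s 1 s1 by have := runs_pop s 0; rewrite s0.
suff [s' [r s'0 s'1 s'2]] : exists s', [/\ runs (read_q p) s 6 s',
    s' 0 = behead w, head false (s' 1) = p &
    head false (s' 2) = if head false (s 1) == head false w
                        then head false (s 2) else head false (s 1)].
  by exists s'; split => //; apply: runs_case; rewrite s0; case: p {s0} r s'1.
case: w @s1 pop1 {s0} => [|q w] s1 pop1.
- have [s' [r s'0 s'1 s'2]] := runs_after_q p false s1.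
  exists s'; split => //; apply: (@runs_seq _ _ _ s1 _ 1 5) => //.
  by apply: runs_case; apply: runs_le r.
- have [s' [r s'0 s'1 s'2]] := runs_after_q p q (upd s1 0 w).
  exists s'; split => //; apply: (@runs_seq _ _ _ s1 _ 1 5) => //; apply: runs_case.
  rewrite /s1 upd_same; have := runs_seq (runs_pop s1 0) r.
  by case: q @s1 r pop1 s'0 s'2.
Qed.

Lemma runs_read_pairs w s : s 0 = w ->
  exists s', [/\ runs (While 0 read_pair) s (8 * size w + 1) s', s' 0 = [::] &
  head false (s' 1) || head false (s' 2) =
    exceeds (head false (s 2)) (head false (s 1)) w].
Proof.
elim/seq2_ind: w s => [|p|p q w IH] s s0.
- by exists s; split => //; exact: runs_while_nil.
- have [s1 [r s10 s11 s12]] := runs_read_pair s0.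
  exists s1; split => //.
    by apply: runs_le (runs_while_step _ r (runs_while_nil _ s10)); rewrite ?s0.
  by rewrite s11 s12 /=; case: (head _ (s 1)).
- have [s1 [r s10 s11 s12]] := runs_read_pair s0.
  have [s2 [r' s20 s2E]] := IH s1 s10.
  exists s2; split => //; last by rewrite s2E s11 s12.
  apply: runs_le (runs_while_step _ r r'); rewrite ?s0 //=; lia.
Qed.

Lemma runs_threshold s : exists2 s',
  runs threshold s (10 * size (s 0) + 10) s' & s' 0 = [:: round_up (s 0)].
Proof.
set s1 := upd s 1 (false :: s 1); set s2 := upd s1 2 (false :: s1 2).
(* A set sign bit erases the word, and the test then answers false because both registers start at
   false. *)
pose w := if head false (s 0) then [::] else behead (s 0).
have sz : size w <= size (s 0).
  by rewrite /w; case: ifP => // _; rewrite size_behead leq_pred.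
have r3 : runs (Case 0 Skip (Pop 0) (clear 0)) s2 (2 * size (s 0) + 2) (upd s2 0 w).
  rewrite addnS; apply: runs_case; rewrite /w [s2 0](_ : _ = s 0) //.
  case s0 : (s 0) => [|[] u] /=.
  - by apply: runs_ext (runs_skip _) => -[|j] //; rewrite /s2 /= s0.
  - have := runs_clear 0 s2; rewrite [s2 0](_ : _ = s 0) // s0.
    by apply: runs_le => /=; lia.
  - have := runs_pop s2 0; rewrite [s2 0](_ : _ = s 0) // s0.
    by apply: runs_le => /=; lia.
have [s4 [r4 s40 s4E]] := runs_read_pairs (upd_same s2 0 w).
exists (upd s4 0 [:: round_up (s 0)]); last by rewrite upd_same.
have r5 : runs (Case 1 (Case 2 (Push 0 false) (Push 0 false) (Push 0 true))
                (Case 2 (Push 0 false) (Push 0 false) (Push 0 true))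
                (Push 0 true)) s4 3 (upd s4 0 [:: round_up (s 0)]).
  have -> : round_up (s 0) = head false (s4 1) || head false (s4 2).
    by rewrite s4E /round_up /w; case: (head _ (s 0)).
  rewrite -s40; apply: runs_if; case: (head false (s4 1)).
    by apply: runs_le (runs_push _ _ _).
  by apply: runs_if; case: (head false (s4 2)); exact: runs_push.
apply: runs_le (runs_seq (runs_push _ _ _) (runs_seq (runs_push _ _ _)
  (runs_seq r3 (runs_seq r4 r5)))).
lia.
Qed.

Lemma ptime_round_up (f : seq bool -> seq bool -> seq bool) :
  ptime f -> ptime (fun x y => [:: round_up (f x y)]).
Proof.
apply: (@ptime_postcomp f (fun w => [:: round_up w]) threshold
  (fun m => 10 * m + 10)) => [|m m' mm'|].
- have idp := poly_dominated_id; have cp := poly_dominated_cst.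
  by apply: poly_dominatedD => //; apply: poly_dominatedM.
- by rewrite leq_add2r leq_mul2l mm'.
- exact: runs_threshold.
Qed.

(** * Sampling algorithms *)

Local Open Scope ring_scope.

Lemma sum_take_tuple (R : realType) (p q : nat) (E : pred (seq bool)) :
  (p <= q)%N ->
  \sum_(r : q.-tuple bool | E (take p r)) (2 ^+ q)^-1 =
  \sum_(r : p.-tuple bool | E r) (2 ^+ p)^-1 :> R.
Proof.
move=> /subnKC <-; move: (q - p)%N => {}q.
rewrite (reindex (fun u : p.-tuple bool * q.-tuple bool => [tuple of u.1 ++ u.2])).
  under eq_bigl => u do rewrite /= take_size_cat ?size_tuple // -[E _]andbT.
  rewrite -(pair_big (fun u : p.-tuple bool => E u) xpredT
    (fun _ _ => (2 ^+ (p + q))^-1)) /=.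
  apply: eq_bigr => u _.
  rewrite sumr_const card_tuple card_bool exprD invfM -mulrnAr -[_ *+ (2 ^ q)]mulr_natr.
  by rewrite natrX mulVf ?mulr1 // expf_neq0 ?pnatr_eq0.
exists (fun r : (p + q).-tuple bool =>
  (tcast (minn_idPl (leq_addr q p)) [tuple of take p r],
   tcast (addKn p q) [tuple of drop p r])) => [[u v]|r] _.
  congr pair; apply: val_inj; rewrite [LHS]val_tcast /=.
    by rewrite take_size_cat ?size_tuple.
  by rewrite drop_size_cat ?size_tuple.
by apply: val_inj; rewrite /= !val_tcast cat_take_drop.
Qed.

(** The common feature of randomized and quantum algorithms on which the advantage estimate rests:
    on each input, the output is a random variable on a finite probability space. *)
Definition sampled (R : realType) (A : algorithm R) : Prop :=
  forall x, exists (I : finType) (w : I -> R) (h : I -> seq bool),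
    [/\ forall i, 0 <= w i, \sum_i w i = 1 &
        forall E : pred (seq bool), A x E = \sum_(i | E (h i)) w i].

Lemma sampled_le (R : realType) (A : algorithm R) x (E F : pred (seq bool)) :
  sampled A -> (forall w, E w -> F w) -> A x E <= A x F.
Proof.
move=> /(_ x) [I [w [h [w0 _ AE]]]] EF; rewrite !AE.
rewrite big_mkcond [leRHS]big_mkcond; apply: ler_sum => i _.
by case: ifP => [/EF ->|_] //; case: ifP.
Qed.

Lemma sampled_disjoint (R : realType) (A : algorithm R) x (E F : pred (seq bool)) :
  sampled A -> (forall w, E w -> ~~ F w) -> A x E + A x F <= 1.
Proof.
move=> /(_ x) [I [w [h [w0 w1 AE]]]] EF; rewrite !AE -w1.
rewrite big_mkcond [X in _ + X]big_mkcond -big_split /=; apply: ler_sum => i _.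
have := EF (h i); case: (E (h i)) => [/(_ isT)/negbTE ->|_]; first by rewrite addr0.
by case: ifP; rewrite add0r.
Qed.

Lemma sampled_le1 (R : realType) (A : algorithm R) x (E : pred (seq bool)) :
  sampled A -> A x E <= 1.
Proof.
move=> sA; have := @sampled_disjoint _ _ x E (predC E) sA.
have : 0 <= A x (predC E).
  by have [I [w [h [w0 _ ->]]]] := sA x; apply: sumr_ge0 => i _.
have h w : E w -> ~~ predC E w by rewrite /= negbK.
by move=> h0 /(_ h) h1; lra.
Qed.

Lemma randomized_sampled (R : realType) (A : algorithm R) :
  randomized_ptime A -> sampled A.
Proof.
move=> [f [a [_ AE]]] x; pose q := poly_bound a (size x).
exists (q.-tuple bool : finType), (fun=> (2 ^+ q)^-1), (fun r : q.-tuple bool => f x r).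
split => [i||E]; last exact: AE.
  by rewrite invr_ge0 exprn_ge0.
rewrite sumr_const card_tuple card_bool -[_ *+ _]mulr_natr natrX mulVf //.
by rewrite expf_neq0 ?pnatr_eq0.
Qed.

(** The distinguisher built from an estimator: [drop 2] turns the unary parameter k into k - 2. *)
Definition rounded (R : realType) (A : algorithm R) : algorithm R :=
  fun x E => A (drop 2 x) (fun w => E [:: round_up w]).

Lemma randomized_rounded (R : realType) (A : algorithm R) :
  randomized_ptime A -> randomized_ptime (rounded A).
Proof.
move=> [f [a [fP AE]]].
exists (fun x r => [:: round_up
  (f (drop 2 x) (take (poly_bound a (size (drop 2 x))) r))]), a.
split; first exact/ptime_round_up/(ptime_drop2 (ptime_truncate a fP)).
move=> x E; rewrite /rounded AE.
rewrite -(sum_take_tuple _ (fun r => E [:: round_up (f (drop 2 x) r)])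
  (q := poly_bound a (size x))) //.
by apply: leq_poly_bound; rewrite size_drop leq_subr.
Qed.

Lemma quantum_rounded (R : realType) (A : algorithm R) :
  quantum_ptime A -> quantum_ptime (rounded A).
Proof.
move=> [c [f [cP [fP AE]]]].
exists (fun x y => c (drop 2 x) y), (fun x y => [:: round_up (f (drop 2 x) y)]).
split; first exact: ptime_drop2.
split; first exact/ptime_round_up/(ptime_drop2 fP).
by move=> x E /=; rewrite /rounded AE.
Qed.

(** * Gates preserve the norm, so the measurement outcomes form a probability distribution *)

Section Unitarity.
Variables (R : realType) (m : nat).
Implicit Types (psi : qstate R m) (x : m.-tuple bool).

Definition sqnorm (z : R[i]) : R := complex.Re z ^+ 2 + complex.Im z ^+ 2.

Lemma qbit_set x i j b : (j < m)%N ->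
  qbit (set_qbit x i b) j = if j == i then b else qbit x j.
Proof.
move=> jm; rewrite /qbit -(tnth_nth _ _ (Ordinal jm)) tnth_mktuple /=.
by case: eqP => // _; rewrite (tnth_nth false).
Qed.

Lemma qbit_inj x y : (forall i, (i < m)%N -> qbit x i = qbit y i) -> x = y.
Proof.
by move=> h; apply: eq_from_tnth => i; rewrite !(tnth_nth false); apply: h.
Qed.

Definition flip (i : nat) x := set_qbit x i (~~ qbit x i).

Lemma qbit_flip x i j : (j < m)%N -> qbit (flip i x) j = (j == i) (+) qbit x j.
Proof. by move=> jm; rewrite qbit_set //; case: eqP => // ->. Qed.

Lemma flipK i : (i < m)%N -> involutive (flip i).
Proof.
by move=> im x; apply: qbit_inj => j jm; rewrite !qbit_flip // addbA addbb.
Qed.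

(** Basis states are paired with their flips; doubling the sum avoids choosing a representative of
    each pair. *)
Lemma sum_flip (F : m.-tuple bool -> R) i : (i < m)%N ->
  (\sum_x F x) *+ 2 = \sum_x (F x + F (flip i x)).
Proof.
move=> im; rewrite big_split mulr2n /=; congr (_ + _).
by rewrite (reindex_inj (inv_inj (flipK im))).
Qed.

Lemma inv_sqrt2_sqr : inv_sqrt2 R ^+ 2 = 2^-1.
Proof. by rewrite exprVn sqr_sqrtr. Qed.

(** The parallelogram law for u + v and u - v, the factor 1/2 coming from the square of
    [inv_sqrt2]. *)
Lemma sqnorm_hadamard (u v : R[i]) (b : bool) :
  sqnorm (Complex (inv_sqrt2 R) 0 * (u + (-1) ^+ b * v)) +
  sqnorm (Complex (inv_sqrt2 R) 0 * (u + (-1) ^+ (~~ b) * v)) =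
  sqnorm u + sqnorm v.
Proof.
have s2 := inv_sqrt2_sqr; move: (inv_sqrt2 R) s2 => s s2.
case: u v => [u1 u2] [v1 v2]; rewrite /sqnorm; case: b; simpc => /=.
all: rewrite ?expr0 ?expr1 ?mulN1r ?mul1r /=.
all: transitivity (s ^+ 2 * ((u1 ^+ 2 + u2 ^+ 2 + (v1 ^+ 2 + v2 ^+ 2)) *+ 2));
  [ring | by rewrite s2; field].
Qed.

Lemma sqnorm_phase (z : R[i]) (b : bool) :
  sqnorm ((if b then Complex (inv_sqrt2 R) (inv_sqrt2 R) else 1) * z) = sqnorm z.
Proof.
have s2 := inv_sqrt2_sqr; move: (inv_sqrt2 R) s2 => s s2.
case: b; last by rewrite mul1r.
case: z => u v; rewrite /sqnorm /=.
transitivity (s ^+ 2 * ((u ^+ 2 + v ^+ 2) *+ 2)); first by ring.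
by rewrite s2; field.
Qed.

(** A Hadamard gate mixes only the amplitudes at x and [flip i x], a phase has modulus one, and CNOT
    permutes the basis states by an involution. *)
Lemma apply_gate_norm psi g :
  \sum_x sqnorm (apply_gate psi g x) = \sum_x sqnorm (psi x).
Proof.
case: g => [i|i|i j] /=.
- case: ifP => // im; apply/(@pmulrnI _ 2 isT).
  rewrite /= !(@sum_flip _ i) //; apply: eq_bigr => x _.
  have setE b : set_qbit (flip i x) i b = set_qbit x i b.
    apply: qbit_inj => j jm; rewrite !qbit_set //.
    by case: eqP => // ji; rewrite qbit_flip //; case: eqP.
  rewrite !setE [qbit (flip i x) i]qbit_flip // eqxx sqnorm_hadamard.
  have : x = set_qbit x i (qbit x i).
    by apply: qbit_inj => j jm; rewrite qbit_set //; case: eqP => // ->.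
  rewrite /flip; case: (qbit x i) => /= <-; first by rewrite addrC.
  by [].
- by case: ifP => // im; apply: eq_bigr => x _; rewrite sqnorm_phase.
- case: ifP => // /and3P[im jm ij].
  have invf : involutive (fun x => set_qbit x j (qbit x j (+) qbit x i)).
    move=> x; apply: qbit_inj => l lm; rewrite !qbit_set // eqxx (negbTE ij).
    by case: eqP => // ->; rewrite -addbA addbb addbF.
  by rewrite [RHS](reindex_inj (inv_inj invf)).
Qed.

Lemma outcome_prob_sum gs : \sum_(y : m.-tuple bool) outcome_prob R gs y = 1.
Proof.
rewrite /outcome_prob -/(sqnorm _).
have -> : \sum_(y : m.-tuple bool) sqnorm (foldl (@apply_gate R m) (@zero_state R m) gs y) =
    \sum_(y : m.-tuple bool) sqnorm (zero_state R y).
  by elim: gs (@zero_state R m) => //= g gs IH psi; rewrite IH apply_gate_norm.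
rewrite (bigD1 [tuple false | _ < m]) //= big1 => [|y /negbTE yn].
  by rewrite /sqnorm /zero_state eqxx /= expr1n expr0n addr0 addr0.
by rewrite /sqnorm /zero_state yn /= expr0n addr0.
Qed.

End Unitarity.

Lemma quantum_sampled (R : realType) (A : algorithm R) :
  quantum_ptime A -> sampled A.
Proof.
move=> [c [f [_ [_ AE]]]] x; set w := c x [::].
exists ((circuit_width w).-tuple bool : finType),
  (outcome_prob R (circuit_gates w)),
  (fun y : (circuit_width w).-tuple bool => f x y).
split => [i||E]; last exact: AE.
  by rewrite addr_ge0 // sqr_ge0.
exact: outcome_prob_sum.
Qed.

(** * Betti numbers *)

Section Betti.
Variables (R : realType) (n : nat).
Implicit Types (G : graph n) (s t : {set 'I_n}).

Lemma clique_sub G s t : t \subset s -> is_clique G s -> is_clique G t.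
Proof.
move=> /fintype.subsetP ts /forallP h; apply/forallP => i; apply/implyP => it.
apply/forallP => j; apply/implyP => jt.
by have /implyP/(_ (ts _ it))/forallP/(_ j)/implyP/(_ (ts _ jt)) := h i.
Qed.

(** The coefficient at t is a sum over ordered pairs of distinct vertices outside t, in which
    opposite orders cancel. *)
Lemma boundary_boundary (c : chain R n) : boundary (boundary c) = 0.
Proof.
apply/ffunP => t; rewrite !ffunE; case: ifP => // _.
pose rank (v : 'I_n) s := #|[set u in s | (u < v)%N]|.
pose F (v u : 'I_n) : R := (-1) ^+ rank v t * ((-1) ^+ rank u (v |: t) * c (u |: (v |: t))).
pose P (p : 'I_n * 'I_n) := [&& p.1 \notin t, p.2 \notin t & p.1 != p.2].
have Pswap p : P (p.2, p.1) = P p.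
  by rewrite /P /= eq_sym andbCA.
have -> : \sum_(v | v \notin t) (-1) ^+ rank v t * boundary c (v |: t) =
    \sum_(p | P p) F p.1 p.2.
  rewrite -(pair_big_dep (fun v => v \notin t)
    (fun v u => (u \notin t) && (v != u)) F) /=.
  apply: eq_bigr => v vt; rewrite ffunE.
  have /negbTE -> : v |: t != set0 by apply/set0Pn; exists v; rewrite setU11.
  rewrite mulr_sumr.
  by apply: eq_bigl => u; rewrite !inE negb_or andbC eq_sym.
(* Of the two orders of insertion, exactly one picks up an additional sign. *)
have rankU (v u : 'I_n) : v \notin t -> rank u (v |: t) = ((v < u) + rank u t)%N.
  move=> vt; rewrite /rank; case: ltnP => vu.
    rewrite (_ : [set _ in _ | _] = v |: [set w in t | (w < u)%N]).
      by rewrite cardsU1 inE (negbTE vt).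
    by apply/setP => w; rewrite !inE; case: eqP => // ->.
  rewrite add0n; apply: eq_card => w; rewrite !inE.
  by case: eqP => // ->; rewrite (negbTE vt) ltnNge vu.
(* Adding two vertices in the opposite order changes the sign. *)
have FN (p : 'I_n * 'I_n) : P p -> F p.2 p.1 = - F p.1 p.2.
  case: p => v u /and3P[/= vt ut vu]; rewrite /F !rankU // setUCA !exprD.
  have : (v < u)%N = ~~ (u < v)%N.
    by rewrite -leqNgt ltn_neqAle vu.
  by case: (u < v)%N => ->; rewrite /=; ring.
have swapK : involutive (fun p : 'I_n * 'I_n => (p.2, p.1)) by case.
have S_opp : \sum_(p | P p) F p.1 p.2 = - \sum_(p | P p) F p.1 p.2.
  rewrite {1}(reindex_inj (inv_inj swapK)) /= (eq_bigl P) // -sumrN.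
  exact: eq_bigr.
by apply/eqP; rewrite -[_ == 0](mulrn_eq0 _ 2) mulr2n {1}S_opp addNr.
Qed.

Lemma cliques_simplices G d s :
  (s \in [set s in skel d (clique_complex G) | #|s| == d.+1]) =
  is_clique G s && (#|s| == d.+1).
Proof.
rewrite !inE; case: (#|s| =P d.+1) => [sd|]; last by rewrite !andbF.
by rewrite sd leqnn !andbT -card_gt0 sd.
Qed.

Lemma betti_skel G d : betti R (skel d (clique_complex G)) d =
  \dim (cycles R (skel d (clique_complex G)) d).
Proof.
rewrite /betti (_ : boundaries _ _ _ = 0%VS) ?dimv0 ?subn0 //.
rewrite /boundaries /chains (_ : [set s in _ | _] = set0).
  by rewrite enum_set0 /= span_nil limg0.
by apply/setP => s; rewrite !inE; case: (#|s| =P d.+2) => [->|]; rewrite ?ltnn !andbF.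
Qed.

Lemma betti_eq0 G d : (forall s, is_clique G s -> #|s| != d.+1) ->
  betti R (skel d (clique_complex G)) d = 0%N.
Proof.
move=> noclique; rewrite betti_skel /cycles /chains (_ : [set s in _ | _] = set0).
  by rewrite enum_set0 /= span_nil cap0v dimv0.
apply/setP => s; rewrite cliques_simplices [RHS]inE.
by apply/negbTE/negP => /andP[/noclique/negbTE ->].
Qed.

(** The simplex s has dimension d + 1 and is cut away from the skeleton, but its facets are cliques
    of dimension d and remain. *)
Lemma boundary_simplex_chains G d s : is_clique G s -> #|s| = d.+2 ->
  boundary (simplex_chain R s) \in chains R (skel d (clique_complex G)) d.
Proof.
move=> sG sd; move cE : (boundary _) => c.
have -> : c = \sum_(t | is_clique G t && (#|t| == d.+1)) c t *: simplex_chain R t.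
  apply/ffunP => t; rewrite sum_ffunE.
  under eq_bigr do rewrite !ffunE.
  have [tP|tP] := boolP (is_clique G t && (#|t| == d.+1)).
    rewrite (bigD1 t) //= eqxx big1 ?addr0 => [|u /andP[_ /negbTE ut]].
      by rewrite /GRing.scale /= mulr1.
    by rewrite eq_sym ut scaler0.
  rewrite big1 => [|u uP]; last first.
    by case: eqP => [tu|_]; [rewrite tu uP in tP | rewrite scaler0].
  rewrite -cE ffunE; case: ifP => // t0; apply: big1 => v vt.
  rewrite ffunE; case: eqP => [vts|_]; last by rewrite mulr0.
  case/negP: tP; rewrite (clique_sub _ sG) /=; last by rewrite -vts subsetUr.
  by have := cardsU1 v t; rewrite vts sd vt add1n => -[<-].
apply: memv_suml => t tP; apply/memvZ/memv_span/mapP; exists t => //.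
by rewrite mem_enum cliques_simplices.
Qed.

(** The coefficient at a facet [s :\ v] is a sign. The size bound makes the facet nonempty; at the
    empty set [boundary] is 0 by convention. *)
Lemma boundary_simplex_neq0 s : (1 < #|s|)%N -> boundary (simplex_chain R s) != 0.
Proof.
move=> s1; have /card_gt0P[v vs] : (0 < #|s|)%N by apply: ltnW.
apply/eqP => /ffunP/(_ (s :\ v)); rewrite !ffunE; case: eqP => [s0|_].
  by have := cardsD1 v s; rewrite s0 vs cards0; lia.
rewrite (bigD1 v) /= ?in_setD1 ?eqxx //= big1 => [|u /andP[us uv]].
  rewrite addr0 ffunE setD1K // eqxx mulr1 => /eqP.
  by rewrite signr_eq0.
rewrite ffunE; case: eqP => [E|_]; last by rewrite mulr0.
have : v \in u |: (s :\ v) by rewrite E.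
by rewrite !inE eqxx orbF eq_sym (negbTE uv).
Qed.

Lemma betti_gt0 G d s : is_clique G s -> #|s| = d.+2 ->
  (0 < betti R (skel d (clique_complex G)) d)%N.
Proof.
move=> sG sd; rewrite betti_skel lt0n dimv_eq0; apply/eqP => cyc0.
have : boundary (simplex_chain R s) \in cycles R (skel d (clique_complex G)) d.
  rewrite memv_cap (boundary_simplex_chains sG sd) memv_ker lfunE /=.
  by rewrite boundary_boundary.
by rewrite cyc0 memv0; apply/negP/boundary_simplex_neq0; rewrite sd.
Qed.

End Betti.

(** * Random graphs *)

Section RandomGraphs.
Variables (R : realType) (n : nat).
Implicit Types (G : graph n) (s : {set 'I_n}) (f g : graph n -> R).

Lemma gnp_weight_half G : gnp_weight 2^-1 G = (2 ^+ #|edge n|)^-1 :> R.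
Proof.
rewrite /gnp_weight -[RHS]exprVn -prodr_const.
by apply: eq_bigr => e _; case: ifP => // _; field.
Qed.

Lemma expect_nullE f :
  expect_null f = (2 ^+ #|edge n|)^-1 * \sum_(G : graph n) f G.
Proof.
by rewrite mulr_sumr; apply: eq_bigr => G _; rewrite gnp_weight_half.
Qed.

Lemma expect_null_le f g :
  (forall G, f G <= g G) -> expect_null f <= expect_null g.
Proof.
move=> fg; rewrite !expect_nullE ler_wpM2l ?invr_ge0 ?exprn_ge0 //.
exact: ler_sum.
Qed.

Lemma expect_nullD f g :
  expect_null (fun G => f G + g G) = expect_null f + expect_null g.
Proof. by rewrite !expect_nullE big_split mulrDr. Qed.

(** Complementation matches the graphs containing F with the subsets of [~: F]. *)
Lemma expect_null_superset (F : {set edge n}) :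
  expect_null (fun G => (F \subset G)%:R) = (2 ^+ #|F|)^-1 :> R.
Proof.
rewrite expect_nullE -natr_sum.
have -> : (\sum_(G : graph n) (F \subset G) = #|[set G : graph n | F \subset G]|)%N.
  by rewrite -sum1dep_card [RHS]big_mkcond; apply: eq_bigr => G _; case: (_ \subset _).
have -> : #|[set G : graph n | F \subset G]| = (2 ^ #|~: F|)%N.
  rewrite -card_powerset -(card_imset _ (can_inj (@setCK (edge n)))).
  apply: eq_card => G; rewrite inE; apply/idP/imsetP => [FG|[H]].
    by exists (~: G); rewrite ?setCK // inE setCS.
  by rewrite inE => HF ->; rewrite -setCS setCK.
rewrite natrX -[in LHS](cardsC F) exprD invfM -mulrA mulVf ?mulr1 //.
by rewrite expf_neq0 ?pnatr_eq0.
Qed.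

Lemma expect_null1 : expect_null (fun _ : graph n => 1) = 1 :> R.
Proof.
transitivity (expect_null (fun G : graph n => (set0 \subset G)%:R) : R).
  by apply: eq_bigr => G _; rewrite sub0set.
by rewrite expect_null_superset cards0 expr0 invr1.
Qed.

Definition inner_edges s : {set edge n} := [set e : edge n | val e \subset s].

Lemma card_inner_edges s : #|inner_edges s| = 'C(#|s|, 2).
Proof.
rewrite -cards_draws -(card_imset _ (@val_inj _ _ (edge n))).
apply: eq_card => e; rewrite inE; apply/imsetP/andP => [[x]|[es e2]].
  by rewrite inE => xs ->; split => //; apply: valP x.
by exists (Sub e e2); rewrite ?inE SubK.
Qed.

Lemma clique_inner_edges G s : is_clique G s -> inner_edges s \subset G.
Proof.
move=> sG; apply/fintype.subsetP => e; rewrite inE => es.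
have /cards2P[i [j [ij eij]]] := valP e.
have [is_ js] : i \in s /\ j \in s.
  by split; apply: (fintype.subsetP es); rewrite eij !inE eqxx ?orbT.
have /implyP/(_ is_)/forallP/(_ j)/implyP/(_ js)/implyP/(_ ij) := forallP sG i.
by case/existsP => e' /andP[e'G /eqP]; rewrite -eij => /val_inj <-.
Qed.

Lemma plant_clique G s : is_clique (plant s G) s.
Proof.
apply/forallP => i; apply/implyP => is_; apply/forallP => j; apply/implyP => js.
apply/implyP => ij; have e2 : #|[set i; j]| == 2 by rewrite cards2 ij.
apply/existsP; exists (Sub [set i; j] e2); rewrite SubK eqxx andbT !inE SubK.
by apply/orP; right; apply/fintype.subsetP => l; rewrite !inE => /orP[]/eqP->.
Qed.

(** Union bound over the m-subsets: a clique on s forces its 'C(m, 2) inner edges to be present. *)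
Lemma expect_null_clique m :
  expect_null (fun G => [exists s, is_clique G s && (#|s| == m)]%:R) <=
  'C(n, m)%:R / 2 ^+ 'C(m, 2) :> R.
Proof.
apply: (@le_trans _ _ (\sum_(s : {set 'I_n} | #|s| == m)
  expect_null (fun G => (inner_edges s \subset G)%:R))); last first.
  rewrite (eq_bigr (fun=> (2 ^+ 'C(m, 2))^-1)) => [|s /eqP sm].
    by rewrite sumr_const -[X in _ *+ X]cardsE card_draws card_ord mulr_natl.
  by rewrite expect_null_superset card_inner_edges sm.
under eq_bigr do rewrite expect_nullE.
rewrite expect_nullE -mulr_sumr ler_wpM2l ?invr_ge0 ?exprn_ge0 //.
rewrite exchange_big; apply: ler_sum => G _ /=.
case: existsP => [[s /andP[sG sm]]|_]; last by apply: sumr_ge0.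
rewrite (bigD1 s) //= clique_inner_edges // lerDl.
by apply: sumr_ge0.
Qed.

(** Planting makes the chosen k-set a clique, so only graphs with a k-clique have to be compared. *)
Lemma expect_planted_le f g k :
  (forall G s, is_clique G s -> #|s| = k -> f G <= g G) ->
  expect_planted k f <= expect_planted k g.
Proof.
move=> fg; apply: ler_sum => s /eqP sk; rewrite ler_wpM2l ?invr_ge0 //.
by apply: expect_null_le => G; apply: fg (plant_clique G s) sk.
Qed.

End RandomGraphs.

(** * The first moment bound in the range of clique sizes considered *)

Lemma bin_le_expn n m : ('C(n, m) <= n ^ m)%N.
Proof.
elim: m n => [|m IH] [|n]; rewrite ?bin0 ?bin0n ?expn0 //.
rewrite -(leq_pmul2l (ltn0Sn m)) -mul_bin_diag expnS.
apply: (@leq_trans (n.+1 * n.+1 ^ m)); last by rewrite leq_pmull.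
rewrite leq_mul2l; apply/orP; right; apply: leq_trans (IH n) _.
by case: m {IH} => // m; rewrite leq_exp2r.
Qed.

Lemma double_bin2 m : (2 * 'C(m, 2) = m.-1 * m)%N.
Proof.
elim: m => // m IH; rewrite binS bin1 mulnDr IH.
by case: m {IH} => //= m; lia.
Qed.

(** After squaring, (n ^ 2) ^ m is compared with (2 ^ (m - 1)) ^ m factor by factor. The spare
    factor (1 + delta ^- 2) ^ m is at least delta ^- 2 and compensates for the delta ^ 2 on the
    right. *)
Lemma clique_count_bound (R : realType) (n m : nat) (delta : R) :
  0 < delta -> (0 < m)%N -> n%:R ^+ 2 * (1 + delta ^- 2) <= 2 ^+ m.-1 ->
  'C(n, m)%:R / 2 ^+ 'C(m, 2) <= delta.
Proof.
move=> d0 m0 H; have d2 : 0 < delta ^- 2 by rewrite invr_gt0 exprn_gt0.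
rewrite ler_pdivrMr ?exprn_gt0 //.
rewrite -(ler_pXn2r (isT : (0 < 2)%N)) ?nnegrE ?mulr_ge0 ?exprn_ge0 ?(ltW d0) //.
rewrite exprMn -exprM mulnC double_bin2 exprM.
apply: (@le_trans _ _ ((n%:R ^+ 2) ^+ m)).
  rewrite -exprM mulnC exprM ler_pXn2r ?nnegrE ?exprn_ge0 //.
  by rewrite -natrX ler_nat bin_le_expn.
apply: (@le_trans _ _ (delta ^+ 2 * (n%:R ^+ 2 * (1 + delta ^- 2)) ^+ m)); last first.
  rewrite ler_wpM2l ?exprn_ge0 ?(ltW d0) //.
  by rewrite ler_pXn2r ?nnegrE ?mulr_ge0 ?exprn_ge0 ?addr_ge0 ?(ltW d2).
rewrite [X in _ <= _ * X]exprMn mulrCA ler_peMr ?exprn_ge0 //.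
rewrite -ler_pdivrMl ?exprn_gt0 // mulr1.
apply: (@le_trans _ _ (1 + delta ^- 2)); first by rewrite lerDr.
by rewrite -[leLHS]expr1 ler_weXn2l // lerDl ltW.
Qed.

Local Open Scope classical_set_scope.
Local Open Scope ring_scope.

Lemma clique_size_growth (R : realType) (eps : R) (k : nat -> nat) (M : R) :
  0 < eps -> (\forall n \near \oo, (2 + eps) * log2 R n < (k n)%:R) ->
  \forall n \near \oo, n%:R ^+ 2 * M <= 2 ^+ k n.
Proof.
move=> e0 hk; near=> n.
have n1 : 1 <= n%:R :> R by near: n; exact: nbhs_infty_ger.
have n0 : 0 < n%:R :> R by apply: lt_le_trans n1.
have l2 : 0 < ln 2 :> R by rewrite ln_gt0 // ltr1n.
(* The hypothesis on k gives 2 ^ k > n ^ 2 * n ^ eps, and this threshold ensures n ^ eps >= 1 + eps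
   * ln n >= M. *)
have nM : expR (M / eps) <= n%:R by near: n; exact: nbhs_infty_ger.
have kn : (2 + eps) * log2 R n < (k n)%:R by near: n.
rewrite -[X in _ <= X ^+ _](@lnK R) ?posrE // -expRM_natl.
rewrite -[X in X ^+ 2](@lnK R) ?posrE // -expRM_natl.
apply: (@le_trans _ _ (expR (2%:R * ln n%:R) * expR (eps * ln n%:R))).
  rewrite ler_wpM2l ?expR_ge0 //; apply: le_trans (expR_ge1Dx _).
  have : M / eps <= ln n%:R by rewrite -[leLHS]expRK ler_ln // posrE expR_gt0.
  by rewrite ler_pdivrMr // mulrC => h; rewrite (le_trans h) // lerDr.
rewrite -expRD ler_expR -mulrDl ltW //.
by move: kn; rewrite /log2 mulrA ltr_pdivrMr.
Unshelve. all: by end_near. Qed.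

(** * The reduction *)

(** An error below 1/2 puts the estimate strictly on one side of 1/2, where the tests 2 P > Q and 2
    P > Q + 1 agree. With the sign bit set the estimate is at most 0, which forces b = 0. *)
Lemma round_up_estimate (R : realType) (w : seq bool) (b : nat) :
  `|estimate R w - b%:R| < 2^-1 -> round_up w = (0 < b)%N.
Proof.
rewrite /estimate /round_up; have := exceedsE false false (behead w).
case: (unzip_bits (behead w)) => ps qs ->.
set P := num_of_bits ps; set Q := num_of_bits qs; rewrite addn0 orbF.
have Q0 : 0 < Q.+1%:R :> R by rewrite ltr0n.
have P0 : 0 <= P%:R / Q.+1%:R :> R by rewrite divr_ge0.
have b1 : (0 < b)%N -> 1 <= b%:R :> R by rewrite ler1n.
case: (head false w) => /=.
  rewrite expr1 mulN1r mulNr ltr_norml => /andP[h _]; case: (posnP b) => // /b1.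
  by move: (P%:R / _) P0 h => e P0 h {}b1; exfalso; lra.
rewrite expr0 mul1r ltr_norml => /andP[h1 h2]; case: (posnP b) => [b0|/b1 {}b1].
  move: h2; rewrite b0 subr0 ltr_pdivrMr // mulrC ltr_pdivlMr // -natrM ltr_nat.
  by move=> h2; apply/negbTE; rewrite -leqNgt; lia.
have : 2^-1 < P%:R / Q.+1%:R :> R by move: (P%:R / _) h1 => e h1; lra.
rewrite ltr_pdivlMr // mulrC ltr_pdivrMr // -natrM ltr_nat.
by lia.
Qed.

Lemma drop2_encode n (G : graph n) (m : nat) :
  (1 < m)%N -> drop 2 (encode G m) = encode G (m - 2).
Proof. by case: m => [|[|m]] // _; rewrite subn2 /encode /= drop0. Qed.

(** Success on the mixture means that the two success probabilities add up to at least 1 + 2 delta.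
    Under planting, success implies acceptance; under the null distribution, success and acceptance
    together have mass at most 1 + delta. The difference leaves delta. *)
Lemma rounded_advantage (R : realType) (A : algorithm R) (n k : nat)
    (delta : R) :
  sampled A -> (2 < k)%N -> 'C(n, k.-1)%:R / 2 ^+ 'C(k.-1, 2) <= delta ->
  2^-1 + delta <= success_prob A n k (k - 2) 2^-1 ->
  delta <= `|expect_null (fun G : graph n => rounded A (encode G k) says_planted) -
             expect_planted k (fun G : graph n => rounded A (encode G k) says_planted)|.
Proof.
move=> sA k2 bound; rewrite /success_prob /expect_mixture.
set S := (X in expect_null X) => success; set accept := fun G => rounded _ _ _.
have kE : (k - 2).+2 = k by lia.
have kE1 : (k - 2).+1 = k.-1 by lia.
have acceptE G : accept G = A (encode G (k - 2)) round_up.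
  by rewrite /accept /rounded drop2_encode // ltnW.
have planted : expect_planted k S <= expect_planted k accept.
  apply: expect_planted_le => G s sG sk; rewrite acceptE.
  apply: sampled_le => // w /round_up_estimate ->.
  by apply: (betti_gt0 _ sG); rewrite kE.
have null : expect_null accept + expect_null S <= 1 + delta.
  apply: le_trans (lerD (lexx _) bound).
  apply: le_trans (lerD (lexx _) (expect_null_clique _ _ _)).
  rewrite -{1}(expect_null1 R n) -!expect_nullD; apply: expect_null_le => G.
  (* If G has a (k - 1)-clique, the indicator pays for bounding both probabilities by 1. Otherwise
     the Betti number is 0, and rounding up excludes success. *)
  rewrite acceptE; case: existsP => [_|noclique] /=.
    by apply: lerD; exact: sampled_le1.
  rewrite addr0; apply: sampled_disjoint => // w up; apply/negP.
  rewrite betti_eq0 => [/round_up_estimate|s sG]; first by rewrite up.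
  by rewrite kE1; apply/negP => sk; apply: noclique; exists s; rewrite sG.
by rewrite ler_normr; apply/orP; right; lra.
Qed.

Lemma rounded_distinguishes (R : realType) (A : algorithm R) (eps delta : R)
    (k : nat -> nat) :
  0 < eps -> 0 < delta ->
  (\forall n \near \oo, (2 + eps) * log2 R n < (k n)%:R) ->
  sampled A -> estimates_betti A k delta ->
  \forall n \near \oo,
    let accept (G : graph n) := rounded A (encode G (k n)) says_planted in
    delta <= `|expect_null accept - expect_planted (k n) accept|.
Proof.
move=> e0 d0 hk sA est.
(* The first moment bound is applied with m = k - 1 and needs 2 ^ (k - 2) on the right; the factor 4
   accounts for the passage from 2 ^ k. *)
have growth := clique_size_growth (4 * (1 + delta ^- 2)) e0 hk.
near=> n; have d2 : 0 < delta ^- 2 by rewrite invr_gt0 exprn_gt0.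
have n2 : 2 <= n%:R :> R by near: n; exact: nbhs_infty_ger.
have h : n%:R ^+ 2 * (4 * (1 + delta ^- 2)) <= 2 ^+ k n by near: n.
(* For n >= 2 the left side of [h] is at least 16, so 2 ^ k exceeds 2 ^ 2. *)
have k2 : (2 < k n)%N.
  rewrite ltnNge; apply/negP => k2.
  have : 2 ^+ k n <= 2 ^+ 2 :> R by rewrite ler_weXn2l // ler1n.
  nra.
apply: (rounded_advantage sA k2); last by near: n.
apply: clique_count_bound => //; first by lia.
have : 2 ^+ k n = 4 * 2 ^+ (k n).-1.-1 :> R.
  by case: (k n) k2 => [|[|m]] //= _; rewrite !exprS; ring.
by move=> E; rewrite E mulrCA ler_pM2l // in h.
Unshelve. all: by end_near. Qed.

Theorem theorem2p1 (R : realType) (eps : R) (heps : 0 < eps < 2^-1)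
    (k : nat -> nat)
    (hk : \forall n \near \oo,
       (2 + eps) * log2 R n < (k n)%:R < n%:R `^ (2^-1 - eps))
    (delta : R) (hdelta : 0 < delta) :
  (PC eps ->
     ~ exists A : algorithm R, randomized_ptime A /\ estimates_betti A k delta)
  /\
  (qPC eps ->
     ~ exists A : algorithm R, quantum_ptime A /\ estimates_betti A k delta).
Proof.
have [e0 _] := andP heps.
have klog : \forall n \near \oo, (2 + eps) * log2 R n < (k n)%:R.
  by apply: filterS hk => n /andP[].
have kle : \forall n \near \oo,
    (2 + eps) * log2 R n <= (k n)%:R <= n%:R `^ (2^-1 - eps).
  by apply: filterS hk => n /andP[h1 h2]; rewrite !ltW.
split=> hardness [A [classA est]]; apply: (hardness k kle delta hdelta);
  exists (rounded A); split.
- exact: randomized_rounded.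
- exact: rounded_distinguishes e0 hdelta klog (randomized_sampled classA) est.
- exact: quantum_rounded.
- exact: rounded_distinguishes e0 hdelta klog (quantum_sampled classA) est.
Qed.
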